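(* Let $P$ be a tree poset of height $k$. For every $\varepsilon>0$ there exists $n_0$ such that for all $n\geq n_0$, the number of families $\mathcal{F}\subseteq\mathcal{B}_n$ that contain no induced copy of $P$ is at most $2^{(k-1+\varepsilon)\binom{n}{\lfloor n/2\rfloor}}$. (Equivalently, the number of induced $P$-free families in $\mathcal{B}_n$ is at most $2^{(k-1+o(1))\binom{n}{\lfloor n/2\rfloor}}$.)
   Context: $\mathcal{B}_n$ is the family of all subsets of $[n]$ ordered by inclusion. A tree poset is a finite poset whose Hasse diagram (as an undirected graph) is a tree; its height is the largest number of elements in a chain. An induced copy of $P$ in $\mathcal{F}$ is the image of an injective map $f:P\to\mathcal{F}$ with $f(x)\subsetneq f(y)$ if and only if $x<_P y$; $\mathcal{F}$ is induced $P$-free if it contains no induced copy of $P$. *)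

(* Defs.v *)
From HB Require Import structures.
From mathcomp Require Import all_boot all_order all_algebra.
From mathcomp Require Import reals exp.
Set Implicit Arguments. Unset Strict Implicit. Unset Printing Implicit Defensive.

Section PosetDefs.
Variables (T : finType) (le : rel T).

Definition plt (x y : T) : bool := le x y && (x != y).

Definition covers (x y : T) : bool :=
  plt x y && ~~ [exists z, plt x z && plt z y].

Definition hasse_adj (x y : T) : bool := covers x y || covers y x.

Definition hasse_cycle (s : seq T) : bool :=
  [&& 2 < size s, uniq s & cycle hasse_adj s].

Definition is_tree_poset : Prop :=
  [/\ 0 < #|T|,
      (forall x y : T, connect hasse_adj x y) &
      (forall s : seq T, ~~ hasse_cycle s)].

Definition is_chain (C : {set T}) : bool :=
  [forall x in C, forall y in C, le x y || le y x].

Definition height : nat := \max_(C : {set T} | is_chain C) #|C|.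

Definition has_induced_copy (n : nat) (F : {set {set 'I_n}}) : bool :=
  [exists f : {ffun T -> {set 'I_n}},
     [&& injectiveb f, [forall x, f x \in F] &
         [forall x, forall y, (f x \proper f y) == plt x y]]].

Definition induced_free (n : nat) (F : {set {set 'I_n}}) : bool :=
  ~~ has_induced_copy F.

End PosetDefs.

(* Main.v *)
Require Import Defs.
From HB Require Import structures.
From mathcomp Require Import all_boot all_order all_algebra.
From mathcomp Require Import reals exp.
From mathcomp Require Import all_fingroup zify ring.
Import Order.TTheory GRing.Theory Num.Theory.
Local Open Scope ring_scope.

(** Supersaturation and a decision-tree container argument.  Write N = 'C(n, n./2), let k be
    the height of P, and choose a strictly monotone rank r : P -> {0, ..., k-1}.

    If A is a family with |A| >= (k-1+c)N, a uniformly random full chain contains on average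
    more than k-1+c sets of A, counted with all windows of k consecutive members.  Repeatedly
    deleting labelled sets (i, F) for which a random full chain through F is unlikely to meet
    level j above (j > i) or below (j < i) F destroys few windows, so a nonempty labelled
    system V survives in which all these probabilities are at least a constant 1/D.

    P is then embedded greedily into F along its Hasse tree, placing x on level r(x) of V.
    Given a partial embedding, all but a tiny proportion of the chains through the parent's
    image avoid unwanted comparabilities (the sets have size n/2 +- R with R a small multiple
    of n), and a single set lies on a proportion O(1/n) of those chains; hence at least n/(8D)
    sets of A extend the embedding.  An induced P-free F must get stuck, and then it misses
    all these sets, which are removed from A.  So O(1) positive answers to the queries
    "is u in F?" pay for the removal of a constant times n sets, and at most O(2^n/n) positive
    answers determine a container of size at most (k-1+c)N.  Since 2^n = O(sqrt n * N), the
    number of containers is 2^o(N). *)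

Set Implicit Arguments.

(** * Membership queries, fingerprints and containers *)

Section DecisionTree.
Local Open Scope nat_scope.
Variable U : finType.
Implicit Types F S : {set U}.

(** A leaf carries a container; the first subtree of [Query] is followed on a positive answer. *)
Inductive dtree := Leaf of {set U} | Query of U & dtree & dtree.

Fixpoint run t F := match t with
  | Leaf C => C
  | Query x t1 t0 => if x \in F then run t1 F else run t0 F
  end.

(** The fingerprint of [F]: only positive answers are recorded, since these are the ones that get
    counted. *)
Fixpoint yes t F : {set U} := match t with
  | Leaf _ => set0
  | Query x t1 t0 => if x \in F then x |: yes t1 F else yes t0 F
  end.

Lemma yes_sub t F : yes t F \subset F.
Proof.
elim: t => [C|x t1 IH1 t0 IH0] /=; first exact: sub0set.
by case: ifP => // xF; rewrite subUset sub1set xF.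
Qed.

(** Positive answers for [F] stay positive for [S] because [S] contains the fingerprint; negative
    ones stay negative because [S] lies in [F]. So the two runs follow the same branch. *)
Lemma run_eq t F S : yes t F \subset S -> S \subset F -> run t S = run t F.
Proof.
move=> + SF; elim: t => [C|x t1 IH1 t0 IH0] //=; case: ifP => xF.
  by rewrite subUset sub1set => /andP[-> /IH1].
by move/IH0 => ->; case: ifP => // /(subsetP SF); rewrite xF.
Qed.

(** Group the families by fingerprint [S]: all families in one class lie inside the single container
    [run t S], which has at most [2 ^ L] subsets. *)
Lemma dtree_count (P : pred {set U}) t s L :
  (forall F, P F -> [&& #|yes t F| <= s, F \subset run t F & #|run t F| <= L]) ->
  #|[set F | P F]| <= #|[set S : {set U} | #|S| <= s]| * 2 ^ L.
Proof.
move=> H; rewrite -sum1_card.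
rewrite (partition_big (yes t) [in [set S : {set U} | #|S| <= s]]) /=; last first.
  by move=> F; rewrite !inE => /H /and3P[].
rewrite -sum_nat_const; apply: leq_sum => S _.
rewrite sum1dep_card.
case: (pickP [pred F | P F & yes t F == S]) => [F0 /andP[PF0 /eqP yF0]|none]; last first.
  by rewrite eq_card0 // => F; move: (none F); rewrite !inE.
have runS F : yes t F == S -> run t F = run t S.
  by move/eqP <-; apply/esym/run_eq => //; exact: yes_sub.
apply: (@leq_trans #|powerset (run t S)|).
  apply: subset_leq_card; apply/subsetP => F; rewrite !inE => /andP[PF yF].
  by rewrite -(runS _ yF); case/and3P: (H _ PF).
rewrite card_powerset leq_exp2l // -(runS F0) ?yF0 //.
by case/and3P: (H _ PF0).
Qed.

(** The elements of [l] are queried in order until the first positive answer. Here [c] counts the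
    positive answers already given, each costs [n] out of a budget [B], and [P] accumulates what
    earlier answers have revealed. *)
Lemma query_seq (n L B c : nat) (l : seq U) (P : {set U} -> Prop) :
  (forall x, x \in l -> exists t, forall F, P F -> x \in F ->
     [/\ (#|yes t F| + c.+1) * n <= B, F \subset run t F & #|run t F| <= L]) ->
  (exists t, forall F, P F -> (forall x, x \in l -> x \notin F) ->
     [/\ (#|yes t F| + c) * n <= B, F \subset run t F & #|run t F| <= L]) ->
  exists t, forall F, P F ->
     [/\ (#|yes t F| + c) * n <= B, F \subset run t F & #|run t F| <= L].
Proof.
elim: l P => [|x l IH] P Hyes [t0 Hno].
  by exists t0 => F PF; apply: Hno.
have [t1 H1] := Hyes x (mem_head _ _).
have [||t2 H2] := IH (fun F => P F /\ x \notin F).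
- move=> y yl; have [|t Ht] := Hyes y; first by rewrite inE yl orbT.
  by exists t => F [PF _]; apply: Ht.
- exists t0 => F [PF xF] lF; apply: Hno => // y; rewrite inE => /orP[/eqP->//|].
  exact: lF.
exists (Query x t1 t2) => F PF /=; case: ifP => xF.
  have [h1 h2 h3] := H1 F PF xF; split=> //.
  apply: leq_trans h1; rewrite leq_mul2r; apply/orP; right.
  rewrite addnS -addSn leq_add2r -add1n.
  by apply: leq_trans (leq_card_setU _ _) _; rewrite cards1.
by apply: H2; rewrite xF.
Qed.

End DecisionTree.

(** * Binomial estimates: small subfamilies, the central coefficient, concentration around the
    middle *)

Section Binomials.
Local Open Scope nat_scope.

Lemma card_sets_by_size (T : finType) (p : pred nat) :
  #|[set A : {set T} | p #|A|]| = \sum_(i < #|T|.+1 | p i) 'C(#|T|, i).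
Proof.
rewrite -sum1_card (partition_big (fun A : {set T} => inord #|A| : 'I_#|T|.+1)
  (fun i => p i)) /=; last first.
  by move=> A; rewrite inE inordK // ltnS max_card.
apply: eq_bigr => i pi; rewrite -card_draws -[RHS]sum1_card; apply: eq_bigl => A.
rewrite !inE; have lt : #|A| < #|T|.+1 by rewrite ltnS max_card.
rewrite -val_eqE /= inordK //.
by case: eqP => [->|]; rewrite ?pi ?andbF.
Qed.

(** Keep the terms with i <= s in the expansion of (b+1)^|T|; for those, b^|T| is at most b^s times
    b^(|T|-i). *)
Lemma small_sets_bound (T : finType) (s b : nat) : 0 < b ->
  #|[set S : {set T} | #|S| <= s]| * b ^ #|T| <= b ^ s * b.+1 ^ #|T|.
Proof.
move=> b0; rewrite (card_sets_by_size T (fun i => i <= s)) big_distrl /=.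
rewrite -[b.+1]addn1 expnDn big_distrr /= [X in _ <= X](bigID (fun i : 'I__ => i <= s)) /=.
apply: leq_trans (leq_addr _ _); apply: leq_sum => i le_is.
rewrite exp1n muln1 mulnCA leq_mul2l -expnD leq_pexp2l ?orbT //.
by rewrite addnBA -1?ltnS // addnC -addnBA // leq_addr.
Qed.

(** Bernoulli's inequality 1 - j/a <= (1 - 1/a)^j, cleared of denominators. *)
Lemma bernoulli_nat (a j : nat) : j <= a -> a ^ j * (a - j) <= a * a.-1 ^ j.
Proof.
elim: j => [|j IH] lt_ja; first by rewrite !expn0 subn0 mul1n muln1.
case: (posnP a.-1) => [a1|a1]; first by rewrite (_ : a - j.+1 = 0) ?muln0 //; lia.
have := IH (ltnW lt_ja); rewrite -(leq_pmul2r a1) => le.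
rewrite !expnSr [X in _ <= X]mulnA; apply: leq_trans le.
rewrite -!mulnA leq_mul2l; apply/orP; right.
have [c ->] : exists c, a = j.+1 + c by exists (a - j.+1); rewrite subnKC.
by rewrite (_ : j.+1 + c - j = c.+1) ?addKn ?addSn /=; nia.
Qed.

(* (1 - 1/(2h))^h >= 1/2 *)
Lemma half_power (h : nat) : 0 < h -> (2 * h) ^ h <= 2 * (2 * h).-1 ^ h.
Proof.
move=> h0; have := @bernoulli_nat (2 * h) h; rewrite leq_pmull // => /(_ isT).
have -> : 2 * h - h = h by lia.
by rewrite mulnAC leq_pmul2r.
Qed.

(** Use [small_sets_bound] with b + 1 = 2^(l+1). The factor (1 + 1/b)^(2^n) is at most 2^(2^(n-l)),
    by raising [half_power] for h = 2^l to the power 2^(n-l). *)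
Lemma small_sets_pow2 (T : finType) (n s l : nat) : #|T| = 2 ^ n -> l < n ->
  #|[set S : {set T} | #|S| <= s]| <= 2 ^ (l.+1 * s + 2 ^ (n - l)).
Proof.
move=> cT ln; set c := #|_|.
set b := (2 * 2 ^ l).-1.
have b1 : b.+1 = 2 ^ l.+1 by rewrite /b prednK ?muln_gt0 ?expn_gt0 // expnS.
have b0 : 0 < b by have : 0 < 2 ^ l; [rewrite expn_gt0 | rewrite /b; lia].
have := small_sets_bound T s b b0; rewrite -/c => le1.
have le2 : b.+1 ^ #|T| <= 2 ^ (2 ^ (n - l)) * b ^ #|T|.
  have := half_power (2 ^ l); rewrite expn_gt0 => /(_ isT).
  rewrite -/b -expnS -b1 -(@leq_exp2r _ _ (2 ^ (n - l))) ?expn_gt0 //.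
  by rewrite expnMn -!expnM -expnD subnKC ?(ltnW ln) // cT.
have : c * b ^ #|T| <= b ^ s * 2 ^ (2 ^ (n - l)) * b ^ #|T|.
  by apply: leq_trans le1 _; rewrite -mulnA leq_mul2l le2 orbT.
rewrite leq_pmul2r ?expn_gt0 ?b0 // => le; apply: leq_trans le _.
rewrite expnD leq_mul2r expnM; apply/orP; right.
case: (posnP s) => [->|s0]; first by rewrite !expn0.
by rewrite leq_exp2r // -b1.
Qed.

(** The bound C(2m,m) >= 4^m / sqrt(4m), squared to stay in the naturals; the induction uses the
    exact ratio of consecutive central coefficients. *)
Lemma central_even (m : nat) : 16 ^ m.+1 <= 4 * m.+1 * 'C(m.+1.*2, m.+1) ^ 2.
Proof.
elim: m => [|m IH]; first by [].
set C := 'C(m.+1.*2, m.+1) in IH; set C' := 'C(_, _).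
have E : m.+2 * C' = 2 * (m.+1.*2).+1 * C.
  have e1 := mul_bin_diag m.+2.*2 m.+1.
  have e2 := mul_bin_down m.+2.*2.-1 m.+1.
  rewrite [_.-1.-1]/= -[in RHS]/C (_ : m.+2.*2.-1 - m.+1 = m.+2) in e2; last by lia.
  have -> : m.+1.*2.+1 = m.+2.*2.-1 by lia.
  rewrite -mulnA /C e2 -e1; set x := 'C(_, _); lia.
move: IH E; rewrite (expnS 16 m.+1); set P := 16 ^ _ => IH E.
rewrite -(leq_pmul2l (m := m.+2 ^ 2)) ?expn_gt0 //.
have -> : m.+2 ^ 2 * (4 * m.+2 * C' ^ 2) = 4 * m.+2 * (m.+2 * C') ^ 2.
  by rewrite expnMn; lia.
rewrite E; apply: (@leq_trans (m.+2 ^ 2 * (16 * (4 * m.+1 * C ^ 2)))); first by rewrite !leq_mul2l IH !orbT.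
by rewrite !expnMn; move: (C ^ 2) => c; nia.
Qed.

Lemma central_bound (n : nat) : 0 < n -> (2 ^ n) ^ 2 <= 4 * n * 'C(n, n./2) ^ 2.
Proof.
move=> n0; rewrite -expnM mulnC expnM; case: (boolP (odd n)) => on.
  (* The odd case follows from the even number n + 1, since C(2m+2,m+1) = 2 C(2m+1,m). *)
  have [m def_n] : exists m, n = m.*2.+1 by exists n./2; lia.
  have -> : n./2 = m by lia.
  have := central_even m; rewrite doubleS binS.
  have -> : 'C(m.*2.+1, m.+1) = 'C(m.*2.+1, m).
    by rewrite -bin_sub; [congr 'C(_, _); lia | lia].
  rewrite -def_n (_ : 16 ^ m.+1 = 4 * 4 ^ n); last first.
    by rewrite def_n -expnS -doubleS -mul2n expnM.
  set c := 'C(_, _); rewrite addnn -mul2n expnMn (_ : 2 ^ 2 = 4) //.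
  by move: (4 ^ n) (c ^ 2) => x y; rewrite def_n; nia.
have [m def_n] : exists m, n = m.+1.*2 by exists n./2.-1; lia.
have -> : n./2 = m.+1 by lia.
rewrite {1}def_n -mul2n expnM; apply: leq_trans (central_even m) _.
by rewrite -def_n leq_mul2r def_n; apply/orP; right; lia.
Qed.

Lemma binomial_sum_shift (n : nat) (f : nat -> int) :
  (\sum_(i < n.+2) 'C(n.+1, i)%:R * f i = \sum_(i < n.+1) 'C(n, i)%:R * (f i + f i.+1))%R.
Proof.
rewrite big_ord_recl /= bin0.
under eq_bigr => i _ do rewrite /bump /= add1n binS natrD mulrDl.
rewrite big_split /= big_ord_recr /= bin_small // mul0r addr0 addrA.
under [in RHS]eq_bigr => i _ do rewrite mulrDr.
rewrite big_split /=; congr (_ + _)%R.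
by rewrite [in RHS]big_ord_recl bin0.
Qed.

(** The second moment of a sum of n random signs. By Pascal's rule, the step reduces to (x+1)^2 +
    (x-1)^2 = 2x^2 + 2 with x = n - 2i. *)
Lemma binomial_variance (n : nat) :
  (\sum_(i < n.+1) 'C(n, i)%:R * (n%:R - 2 * i%:R) ^+ 2 = (n * 2 ^ n)%:R :> int)%R.
Proof.
elim: n => [|n IH]; first by rewrite big_ord1 bin0.
rewrite (binomial_sum_shift n (fun i => (n.+1%:R - 2 * i%:R) ^+ 2)%R).
rewrite (eq_bigr (fun i : 'I_n.+1 => 2 * ('C(n, i)%:R * (n%:R - 2 * i%:R) ^+ 2)
   + 2 * 'C(n, i)%:R)%R); last first.
  by move=> i _; rewrite -!natr1 ; ring.
rewrite big_split /= -!big_distrr /= IH -natr_sum.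
rewrite (eq_bigr (fun i : 'I_n.+1 => 'C(n, i) * (1 ^ (n - i) * 1 ^ i))); last first.
  by move=> i _; rewrite !exp1n !muln1.
by rewrite -expnDn addn1 expnS !natrM -natr1; ring.
Qed.

(** Chebyshev's inequality: every set counted contributes at least R^2 to the second moment. *)
Lemma card_outside (n R : nat) :
  #|[set A : {set 'I_n} | ~~ ((n <= #|A|.*2 + R) && (#|A|.*2 <= n + R))]| * R ^ 2
    <= n * 2 ^ n.
Proof.
rewrite (card_sets_by_size 'I_n (fun i => ~~ ((n <= i.*2 + R) && (i.*2 <= n + R)))).
rewrite card_ord -(ler_nat int) -binomial_variance natrM natr_sum big_distrl /=.
rewrite [leRHS](bigID (fun i : 'I_n.+1 => ~~ ((n <= i.*2 + R) && (i.*2 <= n + R)))) /=.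
apply: ler_wpDr.
  by apply: sumr_ge0 => i _; rewrite mulr_ge0 ?sqr_ge0.
apply: ler_sum => i Hi; apply: ler_wpM2l => //.
rewrite natrX -subr_ge0 subr_sqr !natz.
by move: Hi; rewrite negb_and -!ltnNge => /orP[]; [move=> h; apply: mulr_ge0 | move=> h; apply: mulr_le0]; lia.
Qed.

End Binomials.

(** * Full chains as permutations, and how many pass through given sets *)

Section FullChains.
Local Open Scope nat_scope.
Variable n : nat.
Implicit Types (s : {perm 'I_n}) (F G u : {set 'I_n}) (W : {set {set 'I_n}}).

(** A permutation encodes a full chain by the order in which elements are added, so probabilities
    over random chains become cardinalities of sets of permutations. *)
Definition chain_set s (i : nat) : {set 'I_n} := s @: [set x : 'I_n | x < i].

Definition through F := [set s | chain_set s #|F| == F].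

Lemma card_set_ord F : #|F| <= n.
Proof. by rewrite -[X in _ <= X]card_ord max_card. Qed.

Lemma mem_chain_set s i p : (s p \in chain_set s i) = (p < i).
Proof. by rewrite mem_imset ?inE //; apply: perm_inj. Qed.

Lemma card_ord_lt i : i <= n -> #|[set x : 'I_n | x < i]| = i.
Proof.
move=> le_in; rewrite -sum1dep_card (big_ord_narrow (F := fun=> 1) le_in) /=.
by rewrite sum_nat_const card_ord muln1.
Qed.

Lemma card_chain_set s i : i <= n -> #|chain_set s i| = i.
Proof. by move=> le_in; rewrite card_imset ?card_ord_lt //; apply: perm_inj. Qed.

Lemma throughP s F : reflect (forall p, (s p \in F) = (p < #|F|)) (s \in through F).
Proof.
rewrite inE; apply: (iffP eqP) => [<- p|H].
  by rewrite mem_chain_set card_chain_set // card_set_ord.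
by apply/setP => x; rewrite -(permKV s x) mem_chain_set H.
Qed.

Lemma through_chain_set s i : i <= n -> s \in through (chain_set s i).
Proof. by move=> le_in; rewrite inE card_chain_set. Qed.

Lemma through_sub s F G :
  s \in through F -> s \in through G -> #|F| <= #|G| -> F \subset G.
Proof.
move=> /throughP sF /throughP sG le; apply/subsetP => x.
by rewrite -(permKV s x) sF sG => /leq_trans; apply.
Qed.

Lemma through_proper s F G :
  s \in through F -> s \in through G -> (F \proper G) = (#|F| < #|G|).
Proof.
move=> sF sG; apply/idP/idP => [|lt]; first exact: proper_card.
by rewrite properEcard lt (through_sub sF sG) // ltnW.
Qed.

Lemma through_mulg s F (t : {perm 'I_n}) :
  (forall x, (t x \in F) = (x \in F)) ->
  ((s * t)%g \in through F) = (s \in through F).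
Proof.
move=> tF; apply/throughP/throughP => H p; have := H p; by rewrite permM tF.
Qed.

Lemma tperm_stable (A : {set 'I_n}) a b x :
  a \in A -> b \in A -> (tperm a b x \in A) = (x \in A).
Proof. by move=> aA bA; case: tpermP => [->|->|]; rewrite ?aA ?bA. Qed.

Lemma tperm_stableC (A : {set 'I_n}) a b x :
  a \notin A -> b \notin A -> (tperm a b x \in A) = (x \in A).
Proof. by move=> /negbTE aA /negbTE bA; case: tpermP => [->|->|]; rewrite ?aA ?bA. Qed.

(* Right multiplication by the transpositions (z z') for z' in G carries the left-hand
   event to disjoint events, and preserves [through F]. *)
Lemma card_through_at F G p z : G = F \/ G = ~: F -> z \in G ->
  #|G| * #|[set s in through F | s p == z]| <= #|through F|.
Proof.
move=> GF zG; rewrite mulnC -cardsX.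
have inj : {in setX [set s in through F | s p == z] G &,
    injective (fun y : {perm 'I_n} * 'I_n => (y.1 * tperm z y.2)%g)}.
  move=> [s1 z1] [s2 z2]; rewrite !inE /= => /andP[/andP[_ /eqP e1] _] /andP[/andP[_ /eqP e2] _] E.
  have Ez : z1 = z2.
    by have /permP/(_ p) := E; rewrite !permM e1 e2 !tpermL.
  by move: E; rewrite Ez => /mulIg ->.
rewrite -(card_in_imset inj); apply: subset_leq_card.
apply/subsetP => _ /imsetP[[s z'] /[!inE] /= /andP[/andP[sF _] z'G] ->].
have tF x : (tperm z z' x \in F) = (x \in F).
  case: GF zG z'G => ->; rewrite ?inE; [exact: tperm_stable | exact: tperm_stableC].
by have := through_mulg s tF; rewrite !inE => ->.
Qed.

(* The last element of u on the chain is exchanged with an element outside u. *)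
Lemma card_through_above F u : F \proper u ->
  (n - #|u|) * #|through F :&: through u| <= #|through F|.
Proof.
move=> ltFu; have ltc := proper_card ltFu.
have un := card_set_ord u.
have lt_p : #|u|.-1 < n by lia.
set p := Ordinal lt_p; set Q := [set q : 'I_n | #|u| <= q].
have cQ : #|Q| = n - #|u|.
  have -> : Q = ~: [set q : 'I_n | q < #|u|] by apply/setP => q; rewrite !inE -leqNgt.
  by rewrite cardsCs setCK card_ord card_ord_lt.
have memQ q : (q \in Q) = (#|u| <= q) by rewrite inE.
rewrite mulnC -cQ -cardsX.
have inj : {in setX (through F :&: through u) Q &,
    injective (fun y : {perm 'I_n} * 'I_n => (tperm p y.2 * y.1)%g)}.
  have at_q s (q : 'I_n) : s \in through u -> #|u| <= q -> forall x : 'I_n, #|u| <= x ->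
      ((tperm p q * s)%g x \in u) = (x == q).
    move=> /throughP su uq x ux; rewrite permM su.
    have px : p != x by rewrite -val_eqE neq_ltn /= prednK ?ux // (leq_ltn_trans _ ltc).
    case: (eqVneq x q) => [->|xq]; first by rewrite tpermR /= prednK ?leqnn ?eqxx // (leq_ltn_trans _ ltc).
    have qx : q != x by rewrite eq_sym.
    by rewrite (tpermD px qx) [LHS]ltnNge ux; apply/esym/negbTE.
  move=> [s1 q1] [s2 q2]; rewrite !in_setX !in_setI /= !memQ.
  move=> /andP[/andP[_ s1u] u1] /andP[/andP[_ s2u] u2] E.
  have Eq : q1 = q2.
    by apply/eqP; rewrite -(at_q s2 q2) // -E (at_q s1 q1) // eqxx.
  by move: E; rewrite Eq => /mulgI ->.
rewrite -(card_in_imset inj); apply: subset_leq_card.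
apply/subsetP => _ /imsetP[[s q] + ->]; rewrite in_setX in_setI memQ /=.
move=> /andP[/andP[/throughP sF _] uq]; apply/throughP => x; rewrite permM sF.
have lt_up : #|F| <= p by rewrite -ltnS /= prednK // (leq_ltn_trans _ ltc).
have lt_uq : #|F| <= q by apply: leq_trans uq; exact: ltnW.
by case: tpermP => [->|->|//]; rewrite [LHS]ltnNge [RHS]ltnNge lt_up lt_uq.
Qed.

Lemma perm_of_card F G : #|F| = #|G| ->
  exists t : {perm 'I_n}, forall x, (t x \in G) = (x \in F).
Proof.
move=> FG; pose sF := enum F ++ enum (~: F); pose sG := enum G ++ enum (~: G).
have usz (A : {set 'I_n}) : uniq (enum A ++ enum (~: A)) /\ size (enum A ++ enum (~: A)) = n.
  split; last by rewrite size_cat -!cardE cardsC card_ord.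
  rewrite cat_uniq !enum_uniq /= andbT; apply/hasPn => x.
  by rewrite !mem_enum inE.
have [uF zF] := usz F; have [uG zG] := usz G.
have memF x : x \in sF by rewrite mem_cat !mem_enum inE orbN.
pose h x := nth x sG (index x sF).
have zFG : size sF = size sG := etrans zF (esym zG).
have lt x : index x sF < size sG by rewrite -zFG index_mem.
have h_inj : injective h.
  move=> x y; rewrite /h (set_nth_default y x) // => /eqP.
  rewrite nth_uniq // => /eqP E.
  by rewrite -(nth_index x (memF x)) E nth_index.
exists (perm h_inj) => x; rewrite permE /h nth_cat -cardE -FG index_cat mem_enum.
case: (boolP (x \in F)) => xF.
  have lx : index x (enum F) < #|F| by rewrite cardE index_mem mem_enum.
  by rewrite lx -mem_enum mem_nth // -cardE -FG.
rewrite cardE ltnNge leq_addr /= addKn; apply/negbTE.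
have : nth x (enum (~: G)) (index x (enum (~: F))) \in ~: G.
  rewrite -mem_enum mem_nth // -cardE cardsCs setCK -FG -(setCK F) -cardsCs setCK.
  by rewrite cardE index_mem mem_enum inE.
by rewrite inE.
Qed.

Lemma card_through_same F G : #|F| = #|G| -> #|through F| = #|through G|.
Proof.
move=> FG; have [t tFG] := perm_of_card FG.
rewrite -(card_imset _ (mulIg t)); apply: eq_card => s.
rewrite -[s](mulgKV t) (mem_imset _ _ (mulIg t)); move: (s * t^-1)%g => {}s.
apply/throughP/throughP => H p; have := H p; by rewrite permM tFG FG.
Qed.

(** Each chain passes through exactly one set of size |F|, and all sets of that size carry equally
    many chains. *)
Lemma card_through F : #|through F| * 'C(n, #|F|) = n`!.
Proof.
have le_Fn := card_set_ord F.
rewrite -card_Sn -[in RHS]sum1_card mulnC -[X in 'C(X, _)]card_ord -card_draws.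
rewrite (partition_big (fun s => chain_set s #|F|) [in [set A : {set 'I_n} | #|A| == #|F|]]) /=; last first.
  by move=> s _; rewrite inE card_chain_set.
rewrite -sum_nat_const; apply: eq_bigr => A; rewrite inE => /eqP cA.
rewrite sum1dep_card -(card_through_same cA); apply: eq_card => s.
by rewrite !inE cA.
Qed.

Lemma through_gt0 F : 0 < #|through F|.
Proof. by have := fact_gt0 n; rewrite -(card_through F) muln_gt0 => /andP[]. Qed.

(** The coefficients increase up to the middle; the upper half follows by symmetry. *)
Lemma bin_le_central i : 'C(n, i) <= 'C(n, n./2).
Proof.
have low d j : j + d = n./2 -> 'C(n, j) <= 'C(n, n./2).
  elim: d j => [|d IH] j jd; first by rewrite -jd addn0.
  apply: leq_trans (IH j.+1 _); last by rewrite -jd addSnnS.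
  rewrite -(leq_pmul2l (ltn0Sn j)) mul_bin_left leq_mul2r; apply/orP; right; lia.
case: (leqP i n./2) => le; first by apply: (low (n./2 - i)); rewrite subnKC.
case: (leqP i n) => le_in; last by rewrite bin_small.
by rewrite -bin_sub //; apply: (low (n./2 - (n - i))); lia.
Qed.

Lemma card_through_ge F : n`! <= #|through F| * 'C(n, n./2).
Proof. by rewrite -(card_through F) leq_mul2l bin_le_central orbT. Qed.
End FullChains.

(** * Windows of k consecutive members on a chain, and peeling of non-robust labelled sets *)

Section Supersaturation.
Local Open Scope nat_scope.
Variable n : nat.
Implicit Types (s : {perm 'I_n}) (F G u : {set 'I_n}) (W A : {set {set 'I_n}}).

Definition up_hits F W :=
  [set s in through F | [exists u in W, (s \in through u) && (F \proper u)]].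

Definition down_hits F W :=
  [set s in through F | [exists u in W, (s \in through u) && (u \proper F)]].

Definition chain_seq A s := [seq u <- [seq chain_set s i | i <- iota 0 n.+1] | u \in A].

Lemma mem_chain_seq A s u : (u \in chain_seq A s) = (u \in A) && (s \in through u).
Proof.
rewrite mem_filter; congr (_ && _); apply/mapP/idP => [[i + ->]|].
  by rewrite mem_iota /= add0n ltnS => /through_chain_set.
rewrite inE => /eqP E; exists #|u| => //.
by rewrite mem_iota /= add0n ltnS card_set_ord.
Qed.

Lemma chain_seq_sorted A s : sorted (fun F G => #|F| < #|G|) (chain_seq A s).
Proof.
apply: sorted_filter => [x y z|]; first exact: ltn_trans.
pose card (u : {set 'I_n}) := #|u|.
have E : [seq card u | u <- [seq chain_set s i | i <- iota 0 n.+1]] = iota 0 n.+1.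
  rewrite -map_comp -[RHS]map_id; apply/eq_in_map => i.
  by rewrite mem_iota /= add0n ltnS; exact: card_chain_set.
by move: (iota_ltn_sorted 0 n.+1); rewrite -{1}E sorted_map.
Qed.

Lemma chain_seq_uniq A s : uniq (chain_seq A s).
Proof.
apply: (sorted_uniq _ _ (chain_seq_sorted A s)) => [x y z|x]; first exact: ltn_trans.
by rewrite ltnn.
Qed.

Lemma size_chain_seq A s : size (chain_seq A s) = #|[set u in A | s \in through u]|.
Proof.
rewrite -(card_uniqP (chain_seq_uniq A s)); apply: eq_card => u.
by rewrite mem_chain_seq in_set.
Qed.

Lemma size_chain_seq_le A s : size (chain_seq A s) <= n.+1.
Proof. by rewrite size_filter (leq_trans (count_size _ _)) // size_map size_iota. Qed.

Lemma sum_size_chain_seq A : \sum_s size (chain_seq A s) = \sum_(u in A) #|through u|.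
Proof.
transitivity (\sum_s \sum_(u in A) (s \in through u)).
  apply: eq_bigr => s _; rewrite size_chain_seq -sum1dep_card big_mkcondr.
  by apply: eq_bigr => u _; case: (s \in _).
rewrite exchange_big /=; apply: eq_bigr => u _.
by rewrite -sum1_card [RHS]big_mkcond; apply: eq_bigr => s _; case: (s \in _).
Qed.

Variables (k D : nat) (A : {set {set 'I_n}}).
Hypothesis k_gt0 : 0 < k.
Implicit Type V : {set 'I_k * {set 'I_n}}.

Definition level V (j : 'I_k) : {set {set 'I_n}} := [set u | (j, u) \in V].

Definition robust V (i : 'I_k) F := [forall j : 'I_k,
  ((i < j) ==> (#|through F| <= D * #|up_hits F (level V j)|)) &&
  ((j < i) ==> (#|through F| <= D * #|down_hits F (level V j)|))].

(** Windows are represented by their starting index; a chain has at most n + 1 members, so ['I_n.+2]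
    is large enough. The size condition keeps [nth] away from its default [set0]. *)
Definition windows V s : {set 'I_n.+2} :=
  [set w : 'I_n.+2 | (w + k <= size (chain_seq A s)) &&
    [forall i : 'I_k, (i, nth set0 (chain_seq A s) (w + i)) \in V]].

Lemma nth_chain_seq s i (c := chain_seq A s) : i < size c -> s \in through (nth set0 c i).
Proof. by move=> lt; have := mem_nth set0 lt; rewrite mem_chain_seq => /andP[]. Qed.

Lemma nth_chain_seq_proper s a b (c := chain_seq A s) : a < b -> b < size c ->
  nth set0 c a \proper nth set0 c b.
Proof.
move=> ab bc; have ac := ltn_trans ab bc; rewrite (@through_proper _ s) ?nth_chain_seq //.
have tr : transitive (fun F G : {set 'I_n} => #|F| < #|G|) by move=> x y z; exact: ltn_trans.
exact: (sorted_ltn_nth tr set0 (chain_seq_sorted A s) a b ac bc ab).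
Qed.

(* A window destroyed by the removal of (i, F) has F in position i, and this determines
   the window on the chain. *)
Lemma windows_setD1 V (i : 'I_k) F (H : {set {perm 'I_n}}) s :
  (forall w : 'I_n.+2, w \in windows V s -> nth set0 (chain_seq A s) (w + i) = F -> s \in H) ->
  #|windows V s| <= #|windows (V :\ (i, F)) s| + (s \in H).
Proof.
move=> hitH; set B := [set w in windows V s | nth set0 (chain_seq A s) (w + i) == F].
have sub : windows V s \subset windows (V :\ (i, F)) s :|: B.
  apply/subsetP => w ww; rewrite in_setU [w \in B]in_set ww /= orbC.
  case: eqP => //= wF; move: ww; rewrite !in_set => /andP[-> /forallP /= wV].
  apply/forallP => j; rewrite in_setD1 wV andbT xpair_eqE.
  by apply/negP => /andP[/eqP -> /eqP].
apply: leq_trans (subset_leq_card sub) _; apply: leq_trans (leq_card_setU _ _) _.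
rewrite leq_add2l; case: (pickP (mem B)) => [w0 w0B|none]; last by rewrite eq_card0.
have -> : s \in H by move: w0B; rewrite /= in_set => /andP[+ /eqP]; exact: hitH.
rewrite /= -(cards1 w0); apply: subset_leq_card; apply/subsetP => w wB.
have inB x : x \in B -> x + i < size (chain_seq A s) /\ nth set0 (chain_seq A s) (x + i) = F.
  rewrite !in_set => /andP[/andP[le _] /eqP]; split => //.
  by apply: leq_trans le; rewrite ltn_add2l.
have [l1 e1] := inB _ wB; have [l2 e2] := inB _ w0B.
rewrite inE -val_eqE -(eqn_add2r i) /= -(nth_uniq set0 l1 l2) ?chain_seq_uniq //.
by rewrite e1 e2.
Qed.

Lemma window_up_hit V (i j : 'I_k) F (w : 'I_n.+2) s : w \in windows V s -> i < j ->
  nth set0 (chain_seq A s) (w + i) = F -> s \in up_hits F (level V j).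
Proof.
rewrite in_set => /andP[le /forallP /= wV] ij wF.
have lj : w + j < size (chain_seq A s) by apply: leq_trans le; rewrite ltn_add2l.
have li : w + i < size (chain_seq A s) by apply: ltn_trans lj; rewrite ltn_add2l.
rewrite in_set -{1}wF nth_chain_seq //; apply/existsP; exists (nth set0 (chain_seq A s) (w + j)).
by rewrite in_set wV nth_chain_seq // -wF nth_chain_seq_proper // ltn_add2l.
Qed.

Lemma window_down_hit V (i j : 'I_k) F (w : 'I_n.+2) s : w \in windows V s -> j < i ->
  nth set0 (chain_seq A s) (w + i) = F -> s \in down_hits F (level V j).
Proof.
rewrite in_set => /andP[le /forallP /= wV] ij wF.
have li : w + i < size (chain_seq A s) by apply: leq_trans le; rewrite ltn_add2l.
have lj : w + j < size (chain_seq A s) by apply: ltn_trans li; rewrite ltn_add2l.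
rewrite in_set -{1}wF nth_chain_seq //; apply/existsP; exists (nth set0 (chain_seq A s) (w + j)).
by rewrite in_set wV nth_chain_seq // -wF nth_chain_seq_proper // ltn_add2l.
Qed.

(** Remove a non-robust (i, F): some level is met by fewer than |through F| / D chains through F,
    and only on those is a window lost, at most one per chain. Repeating until nothing is left
    charges every window to a removal. *)
Lemma windows_peeling V :
  (forall W : {set 'I_k * {set 'I_n}}, W \subset V -> (forall x, x \in W -> robust W x.1 x.2) -> W = set0) ->
  D * \sum_s #|windows V s| <= \sum_(x in V) #|through x.2|.
Proof.
have [m] := ubnP #|V|; elim: m V => // m IH V ltm noW.
case: (eqVneq V set0) => [->|V0].
  rewrite big1 ?muln0 // => s _; apply: eq_card0 => w.
  rewrite in_set; apply/negbTE; rewrite negb_and; apply/orP; right.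
  by apply/forallP => /(_ (Ordinal k_gt0)); rewrite in_set0.
have /existsP[[i F] /andP[iFV nrob]] : [exists x in V, ~~ robust V x.1 x.2].
  apply: contraNT V0 => /existsPn rob; apply/eqP/noW => // x xV.
  by have := rob x; rewrite xV /= negbK.
(* [H] consists of the chains that meet the level [j] at which robustness fails. *)
have [H [cH hitH]] : exists H : {set {perm 'I_n}}, D * #|H| <= #|through F| /\
    forall s (w : 'I_n.+2), w \in windows V s -> nth set0 (chain_seq A s) (w + i) = F -> s \in H.
  move: nrob => /forallPn[j]; rewrite negb_and !negb_imply -!ltnNge.
  case/orP => /andP[ij lt]; [exists (up_hits F (level V j)) | exists (down_hits F (level V j))];
    split=> [|s w ws]; try exact: ltnW.
  - exact: window_up_hit ws ij.
  - exact: window_down_hit ws ij.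
rewrite (big_setD1 _ iFV) /=; apply: leq_trans (leq_add cH (IH (V :\ (i, F)) _ _)).
- rewrite -mulnDr leq_mul2l addnC -[#|H|]sum1_card (big_mkcond [in H]) -big_split /=.
  apply/orP; right.
  apply: leq_sum => s _. apply: leq_trans (@windows_setD1 V i F H s (hitH s)) _.
  by rewrite leq_add2l; case: (s \in H).
- by rewrite (cardsD1 (i, F)) iFV in ltm.
- by move=> W WV; apply: noW; apply: subset_trans WV (subD1set _ _).
Qed.

(** A chain with X >= k members of A has a window starting at each of the indices 0, ..., X - k. *)
Lemma card_windows_full s :
  size (chain_seq A s) <= #|windows (setX setT A) s| + k.-1.
Proof.
set X := size _; case: (leqP k X) => kX; last by rewrite (leq_trans _ (leq_addl _ _)) //; lia.
have XA : X - k + 1 <= n.+2 by have := size_chain_seq_le A s; rewrite -/X; lia.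
suff : X - k + 1 <= #|windows (setX setT A) s| by lia.
have inj : injective (widen_ord XA) by move=> x y /(congr1 val) /= /val_inj.
rewrite -[leqLHS]card_ord -(card_imset _ inj).
apply: subset_leq_card; apply/subsetP => _ /imsetP[w _ ->].
have wk : w + k <= X by have := ltn_ord w; lia.
rewrite in_set /= wk; apply/forallP => i; rewrite in_setX in_setT /=.
have lt : w + i < size (chain_seq A s) by apply: leq_trans wk; rewrite ltn_add2l.
by have := mem_nth set0 lt; rewrite mem_chain_seq => /andP[].
Qed.

Lemma sum_windows_full :
  \sum_(u in A) #|through u| <= \sum_s #|windows (setX setT A) s| + k.-1 * n`!.
Proof.
rewrite -sum_size_chain_seq -card_Sn mulnC -sum_nat_const -big_split /=.
by rewrite [X in _ <= X](eq_bigl predT) => [|s]; [apply: leq_sum => s _; exact: card_windows_full | ].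
Qed.

End Supersaturation.

(** * Large families contain a nonempty robust system *)

Section Robust.
Local Open Scope nat_scope.

(** The surplus over k - 1 is c = 1/E. With S the sum of |through u| over A, there are at least S -
    (k-1) n! windows, while peeling everything would allow at most kS/D. *)
Lemma robust_exists (n k E : nat) (A : {set {set 'I_n}}) :
  0 < k -> (k.-1 * E + 1) * 'C(n, n./2) <= #|A| * E ->
  exists2 V : {set 'I_k * {set 'I_n}}, V != set0 & forall x, x \in V ->
    x.2 \in A /\ robust (k * (k.-1 * E + 1)).+1 V x.1 x.2.
Proof.
move=> k0 bigA; set D := _.+1; pose V0 := setX [set: 'I_k] A.
case: (pickP [pred W : {set 'I_k * {set 'I_n}} | [&& W \subset V0, W != set0 &
   [forall x in W, robust D W x.1 x.2]]]) => [W /and3P[WV W0 /forallP rob]|none].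
  exists W => // x xW; split; last by have := rob x; rewrite xW.
  by move: (subsetP WV x xW); case: (x) => i u; rewrite in_setX => /andP[].
have le1 : D * \sum_s #|windows A V0 s| <= \sum_(x in V0) #|through x.2|.
  apply: windows_peeling => // W WV rob; apply/eqP/negP => /negP W0.
  by have := none W; rewrite /= WV W0 => /negP[]; apply/forallP => x; apply/implyP/rob.
have le2 := @sum_windows_full n k A k0; rewrite -/V0 in le2.
have eqS : \sum_(x in V0) #|through x.2| = k * \sum_(u in A) #|through u|.
  rewrite -[k in RHS]card_ord -sum_nat_const.
  rewrite (pair_big (fun i : 'I_k => i \in 'I_k) (fun u => u \in A) (fun _ u => #|through u|)) /=.
  by apply: eq_bigl => -[i u]; rewrite in_setX in_setT.
rewrite {}eqS in le1; set S := \sum_(u in A) _ in le1 le2 *; set W := \sum_s _ in le1 le2 *.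
have le3 : #|A| * n`! <= S * 'C(n, n./2).
  by rewrite -sum_nat_const big_distrl /=; apply: leq_sum => u _; exact: card_through_ge.
have N0 : 0 < 'C(n, n./2) by rewrite bin_gt0; lia.
have f0 := fact_gt0 n.
move: bigA le1 le2 le3; rewrite /D; set q := k.-1 * E + 1.
move: S W n`! 'C(n, n./2) N0 f0 #|A| => S W f N N0 f0 a h1 h2 h3 h4.
exfalso.
have d1 : (k * q).+1 * S <= k * S + (k * q).+1 * (k.-1 * f).
  apply: (@leq_trans ((k * q).+1 * (W + k.-1 * f))); first by rewrite leq_mul2l h3.
  by rewrite mulnDr leq_add2r.
have d2 : ((k * q).+1 - k) * S <= (k * q).+1 * (k.-1 * f) by rewrite mulnBl leq_subLR.
have d3 : ((k * q).+1 - k) * (q * N * f) <= (k * q).+1 * (k.-1 * f) * N * E.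
  apply: (@leq_trans (((k * q).+1 - k) * (a * E * f))).
    by rewrite leq_mul2l leq_mul2r h1 !orbT.
  apply: (@leq_trans (((k * q).+1 - k) * (S * N * E))).
    by rewrite leq_mul2l mulnAC leq_mul2r h4 !orbT.
  by rewrite !mulnA -(mulnA _ N E) -[in leqRHS](mulnA _ N E) leq_mul2r -[in leqRHS]mulnA d2 orbT.
have d4 : ((k * q).+1 - k) * q * (N * f) <= (k * q).+1 * (k.-1 * E) * (N * f).
  by apply: leq_trans (leq_trans d3 _); rewrite leq_eqVlt; apply/orP; left; apply/eqP; ring.
rewrite leq_pmul2r ?muln_gt0 ?N0 // in d4.
have q0 : 0 < q by rewrite /q addn1.
have : k <= k * q by rewrite leq_pmulr.
have qE : k.-1 * E = q.-1 by rewrite /q addn1.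
(* Now (D - k) q <= D (q - 1), that is D <= kq, whereas D = kq + 1: this is what fixes the value of
   D. *)
by rewrite qE in d4; clear -d4 q0; move: d4; case: q q0 => //= p _; nia.
Qed.
End Robust.

Lemma leq_card_bigcup (I T : finType) (P : pred I) (B : I -> {set T}) :
  (#|\bigcup_(i | P i) B i| <= \sum_(i | P i) #|B i|)%N.
Proof.
elim/big_rec2: _ => [|i b A _ le]; first by rewrite cards0.
by apply: leq_trans (leq_card_setU _ _) _; rewrite leq_add2l.
Qed.

(** * Many ways to extend a partial embedding by one set *)

Section Extension.
Local Open Scope nat_scope.
Variables n R : nat.
Implicit Types (s : {perm 'I_n}) (F G u g : {set 'I_n}) (W : {set {set 'I_n}}).

Definition middle F := (n <= #|F|.*2 + R) && (#|F|.*2 <= n + R).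

Lemma card_setC_ord F : #|~: F| = n - #|F|.
Proof. by have := cardsC F; rewrite card_ord; lia. Qed.

Lemma card_through_pairs F (Q : {set 'I_n * 'I_n}) : (forall x, x \in Q -> x.2 \notin F) ->
  (n - #|F|) * #|[set s in through F | [exists x in Q, s x.1 == x.2]]| <= #|Q| * #|through F|.
Proof.
move=> QF; pose B (x : 'I_n * 'I_n) := [set s in through F | s x.1 == x.2].
apply: (@leq_trans (\sum_(x in Q) (n - #|F|) * #|B x|)); last first.
  rewrite -sum_nat_const; apply: leq_sum => x xQ.
  rewrite -card_setC_ord.
  by apply: card_through_at; [right | rewrite inE QF].
rewrite -big_distrr /= leq_mul2l; apply/orP; right.
apply: leq_trans (@leq_card_bigcup _ _ (fun x => x \in Q) B); apply: subset_leq_card; apply/subsetP => s.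
rewrite in_set => /andP[sF /existsP[x /andP[xQ e]]].
by apply/bigcupP; exists x => //; rewrite in_set sF.
Qed.

Lemma card_ord_between (a d : nat) : a <= n -> #|[set p : 'I_n | a <= p < a + d]| <= d.
Proof.
move=> an; have [b [bn ab bd sub]] : exists b, [/\ b <= n, a <= b, b - a <= d &
    [set p : 'I_n | a <= p < a + d] \subset [set p : 'I_n | p < b] :\: [set p : 'I_n | p < a]].
  exists (minn n (a + d)); split; try lia.
  by apply/subsetP => p; rewrite !inE => /andP[h1 h2]; rewrite -leqNgt h1 ltn_min ltn_ord.
apply: leq_trans (subset_leq_card sub) _; rewrite cardsDS ?card_ord_lt //.
by apply/subsetP => p; rewrite !inE => /leq_trans; apply.
Qed.

Lemma below_middle F : 2 * R <= n -> middle F -> n <= 4 * (n - #|F|).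
Proof. by move=> Rn /andP[_]; lia. Qed.

Lemma middle_card F G : middle F -> middle G -> #|G| <= #|F| + R.
Proof.
move=> /andP[nF _] /andP[_ Gn]; rewrite -leq_double doubleD; apply: leq_trans Gn _.
by rewrite -(addnn R) addnA leq_add2r.
Qed.

(** Each unwanted comparability forces the chain to put a certain element outside F at a certain
    position. If u contains g but F does not, a fixed z in g minus F appears between positions |F|
    and |F| + R. If u lies in g, the element added right after F is one of the at most R elements of
    g minus F. *)
Lemma card_avoid F g : middle F -> middle g -> exists Q : {set 'I_n * 'I_n},
  [/\ #|Q| <= 2 * R, forall x, x \in Q -> x.2 \notin F &
   forall s u, middle u -> s \in through F -> s \in through u -> F \proper u ->
     ~~ (g \subset F) && (g \subset u) || (u \subset g) ->
     exists2 x, x \in Q & s x.1 = x.2].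
Proof.
move=> mF mg.
have [Q1 [c1 F1 P1]] : exists Q : {set 'I_n * 'I_n},
  [/\ #|Q| <= R, forall x, x \in Q -> x.2 \notin F &
   forall s u, middle u -> s \in through F -> s \in through u ->
     ~~ (g \subset F) && (g \subset u) -> exists2 x, x \in Q & s x.1 = x.2].
  case: (boolP (g \subset F)) => [_|/subsetPn[z zg zF]].
    by exists set0; split=> [|x|//]; rewrite ?cards0 ?in_set0.
  exists (setX [set p : 'I_n | #|F| <= p < #|F| + R] [set z]); split.
  - by rewrite cardsX cards1 muln1 card_ord_between // card_set_ord.
  - by move=> [p y]; rewrite in_setX in_set1 => /andP[_ /eqP ->].
  - move=> s u mu sF su /= gu; exists ((s^-1)%g z, z); last by rewrite permKV.
    rewrite in_setX in_set1 eqxx andbT in_set.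
    have h1 : #|F| <= (s^-1)%g z by rewrite leqNgt -(throughP _ _ sF) permKV.
    have h2 : (s^-1)%g z < #|u| by rewrite -(throughP _ _ su) permKV (subsetP gu).
    by rewrite h1 (leq_trans h2) // middle_card.
have [Q2 [c2 F2 P2]] : exists Q : {set 'I_n * 'I_n},
  [/\ #|Q| <= R, forall x, x \in Q -> x.2 \notin F &
   forall s u, s \in through F -> s \in through u -> F \proper u ->
     u \subset g -> exists2 x, x \in Q & s x.1 = x.2].
  case: (boolP (F \subset g)) => [Fg|nFg]; last first.
    exists set0; split=> [|x|s u _ _ Fu ug]; rewrite ?cards0 ?in_set0 //.
    by rewrite (subset_trans (proper_sub Fu) ug) in nFg.
  exists (setX [set p : 'I_n | #|F| <= p < #|F| + 1] (g :\: F)); split.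
  - rewrite cardsX (@leq_trans (1 * #|g :\: F|)) ?leq_mul2r ?card_ord_between ?orbT //.
      exact: card_set_ord.
    by rewrite mul1n cardsDS // leq_subLR middle_card.
  - by move=> [p y]; rewrite in_setX in_setD => /andP[_ /andP[]].
  - move=> s u sF su Fu ug; have lt : #|F| < n := leq_trans (proper_card Fu) (card_set_ord u).
    exists (Ordinal lt, s (Ordinal lt)) => //.
    rewrite in_setX in_set in_setD (throughP _ _ sF) /= leqnn addn1 ltnS leqnn ltnn /=.
    by apply: (subsetP ug); rewrite (throughP _ _ su) /= proper_card.
exists (Q1 :|: Q2); split=> [|x|s u mu sF su Fu].
- by rewrite mul2n -addnn; apply: leq_trans (leq_card_setU _ _) (leq_add c1 c2).
- by rewrite inE => /orP[]; [exact: F1 | exact: F2].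
- case/orP => [/(P1 s u mu sF su)|/(P2 s u sF su Fu)] [x xQ e]; exists x => //.
    by rewrite inE xQ.
  by rewrite inE xQ orbT.
Qed.

(** Among chains through F, a proportion at least 1/D hits W above F. At most 8mR/n <= 1/(2D) of
    them are spoilt by some g in X, and each good u accounts for at most 4/n, so at least n/(8D)
    good sets are needed. *)
Lemma up_many (m D : nat) F (X : seq {set 'I_n}) W :
  2 * R <= n -> 16 * m * D * R <= n -> size X <= m ->
  middle F -> all middle X -> (forall u, u \in W -> middle u) ->
  #|through F| <= D * #|up_hits F W| ->
  n <= 8 * D * #|[set u in W | [&& F \proper u,
    all (fun g => (g \subset F) || ~~ (g \subset u)) X & all (fun g => ~~ (u \subset g)) X]]|.
Proof.
move=> Rn mDR sX mF mX mW rob; set N := [set u in W | _].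
have [Q [cQ QF QP]] : exists Q : {set 'I_n * 'I_n},
  [/\ #|Q| <= size X * (2 * R), forall x, x \in Q -> x.2 \notin F &
   forall s u g, g \in X -> middle u -> s \in through F -> s \in through u -> F \proper u ->
     ~~ (g \subset F) && (g \subset u) || (u \subset g) ->
     exists2 x, x \in Q & s x.1 = x.2].
  elim: X mX {sX N} => [_|g X IH /andP[mg /IH [Q [cQ QF QP]]]].
    by exists set0; split => [|x|s u g]; rewrite ?cards0 ?inE.
  have [Q' [cQ' QF' QP']] := @card_avoid F g mF mg.
  exists (Q' :|: Q); split=> [|x|s u h].
  - by rewrite /= mulSn; apply: leq_trans (leq_card_setU _ _) (leq_add cQ' cQ).
  - by rewrite inE => /orP[]; [exact: QF' | exact: QF].
  - rewrite inE => /predU1P[->|hX] mu sF su Fu bad.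
      by have [x xQ e] := QP' s u mu sF su Fu bad; exists x; rewrite // inE xQ.
    by have [x xQ e] := QP s u h hX mu sF su Fu bad; exists x; rewrite // inE xQ orbT.
(* The spoilt chains; any other hitting chain passes through a set of [N]. *)
pose B := [set s in through F | [exists x in Q, s x.1 == x.2]].
have le1 : #|up_hits F W| <= \sum_(u in N) #|through F :&: through u| + #|B|.
  have sub : up_hits F W \subset \bigcup_(u in N) (through F :&: through u) :|: B.
    apply/subsetP => s; rewrite in_set => /andP[sF /existsP[u /and3P[uW su Fu]]].
    rewrite in_setU; case: (boolP (u \in N)) => uN.
      by apply/orP; left; apply/bigcupP; exists u; rewrite // inE sF.
    apply/orP; right; rewrite in_set sF /=.
    have [g gX bad] : exists2 g, g \in X & ~~ (g \subset F) && (g \subset u) || (u \subset g).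
      move: uN; rewrite in_set uW Fu /= negb_and => /orP[] /allPn[g gX h]; exists g => //.
        by move: h; rewrite negb_or negbK => ->.
      by move: h; rewrite negbK => ->; rewrite orbT.
    have [x xQ e] := QP s u g gX (mW u uW) sF su Fu bad.
    by apply/existsP; exists x; rewrite xQ e /=.
  apply: leq_trans (subset_leq_card sub) _; apply: leq_trans (leq_card_setU _ _) _.
  by rewrite leq_add2r; exact: leq_card_bigcup.
have le2 : n * \sum_(u in N) #|through F :&: through u| <= 4 * #|N| * #|through F|.
  rewrite big_distrr /= -mulnA mulnCA -sum_nat_const.
  apply: leq_sum => u; rewrite inE => /and3P[uW Fu _].
  apply: leq_trans (leq_mul (leqnn 4) (@card_through_above n F u Fu)).
  by rewrite mulnA leq_mul2r below_middle ?orbT // mW.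
have le3 : n * #|B| <= 8 * m * R * #|through F|.
  apply: (@leq_trans (4 * (#|Q| * #|through F|))).
    apply: leq_trans (leq_mul (leqnn 4) (@card_through_pairs F Q QF)).
    by rewrite mulnA leq_mul2r below_middle ?orbT.
  rewrite mulnA leq_mul2r; apply/orP; right.
  apply: (@leq_trans (4 * (size X * (2 * R)))); first by rewrite leq_mul2l cQ.
  by rewrite (_ : 8 * m * R = 4 * (m * (2 * R))) ?leq_mul2l ?leq_mul2r ?sX ?orbT //; lia.
have T0 := through_gt0 F.
move: rob le1 le2 le3 T0; set T := #|through F|; set S := \sum_(u in N) _.
move: #|up_hits F W| #|B| #|N| S T => H b N' S T rob le1 le2 le3 T0.
have h1 : n * T <= D * (4 * N' * T + 8 * m * R * T).
  apply: (@leq_trans (n * (D * (S + b)))).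
    by rewrite leq_mul2l (leq_trans rob) ?orbT // leq_mul2l le1 orbT.
  by rewrite mulnCA leq_mul2l mulnDr leq_add ?orbT.
have : n * T <= (4 * D * N' + 8 * m * D * R) * T.
  by apply: leq_trans h1 _; rewrite leq_eqVlt; apply/orP; left; apply/eqP; ring.
rewrite leq_pmul2r // => h2; move: mDR h2.
rewrite -(mulnA 4) -(mulnA 8) -!(mulnA 16) -!(mulnA 8); move: (D * N') (m * (D * R)) => x y; lia.
Qed.

(* The chain of [flip s] consists of the complements of the sets on the chain of s. *)
Definition flip s : {perm 'I_n} := (perm (@rev_ord_inj n) * s)%g.

Lemma flipK : involutive flip.
Proof. by move=> s; apply/permP => x; rewrite !permM !permE rev_ordK. Qed.

Lemma flip_through s F : (flip s \in through (~: F)) = (s \in through F).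
Proof.
have imp t G : t \in through G -> flip t \in through (~: G).
  move=> /throughP tG; apply/throughP => x; rewrite permM permE inE tG.
  rewrite card_setC_ord -leqNgt /=.
  by have := ltn_ord x; lia.
by apply/idP/idP => [/imp|/imp //]; rewrite flipK setCK.
Qed.

Lemma card_down_hits F W : #|down_hits F W| = #|up_hits (~: F) [set ~: u | u in W]|.
Proof.
rewrite -(card_imset _ (inv_inj flipK)); apply: eq_card => s.
rewrite -[s]flipK (mem_imset _ _ (inv_inj flipK)) in_set [in RHS]in_set flip_through.
congr (_ && _); apply/existsP/existsP => [[u /and3P[uW su uF]]|[v /and3P[/imsetP[u uW ->] su uF]]].
  by exists (~: u); rewrite imset_f // flip_through su properC.
by exists u; rewrite uW -flip_through su -properC.
Qed.

Lemma middleC F : middle (~: F) = middle F.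
Proof.
rewrite /middle card_setC_ord; have := card_set_ord F; move: #|F| => f le.
by apply/andP/andP => -[]; split; lia.
Qed.

(** Complementation reverses inclusion and preserves the middle layers, so this is [up_many] for the
    complements. *)
Lemma down_many (m D : nat) F (X : seq {set 'I_n}) W :
  2 * R <= n -> 16 * m * D * R <= n -> size X <= m ->
  middle F -> all middle X -> (forall u, u \in W -> middle u) ->
  #|through F| <= D * #|down_hits F W| ->
  n <= 8 * D * #|[set u in W | [&& u \proper F,
    all (fun g => (F \subset g) || ~~ (u \subset g)) X & all (fun g => ~~ (g \subset u)) X]]|.
Proof.
move=> Rn mDR sX mF mX mW; rewrite card_down_hits => rob.
have cT : #|through (~: F)| = #|through F|.
  rewrite -(card_imset (through F) (inv_inj flipK)); apply: eq_card => s.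
  by rewrite -[s]flipK flip_through (mem_imset _ _ (inv_inj flipK)).
rewrite -cT in rob.
have := @up_many m D (~: F) [seq ~: g | g <- X] [set ~: u | u in W] Rn mDR.
rewrite size_map middleC all_map (eq_all middleC) => /(_ sX mF mX _ rob) le.
have {}le := le _; apply: leq_trans (le _) _ => [_ /imsetP[u uW ->]|].
  by rewrite middleC mW.
rewrite leq_mul2l; apply/orP; right.
rewrite -[leqRHS](card_imset _ (inv_inj (@setCK _))); apply: subset_leq_card.
apply/subsetP => v; rewrite in_set => /and4P[/imsetP[u uW ->] uF a1 a2].
apply: imset_f; rewrite in_set uW -properC uF /=; apply/andP; split.
  by move: a1; rewrite all_map; apply: sub_all => g /=; rewrite !setCS.
by move: a2; rewrite all_map; apply: sub_all => g /=; rewrite !setCS.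
Qed.
End Extension.

Unset Strict Implicit.

(** * Rank, and attaching one vertex to a connected part of the Hasse tree *)

Section TreePosets.
Local Open Scope nat_scope.
Variables (T : finType) (le : rel T).
Hypotheses (le_refl : reflexive le) (le_anti : antisymmetric le) (le_trans : transitive le).

Local Notation lt := (plt le).
Local Notation adj := (hasse_adj le).

Lemma plt_trans : transitive lt.
Proof.
move=> y x z /andP[xy nxy] /andP[yz nyz]; rewrite /plt (le_trans xy yz) /=.
by apply: contra nxy => /eqP xz; rewrite -xz in yz; apply/eqP/le_anti; rewrite xy yz.
Qed.

Lemma plt_irr x : lt x x = false.
Proof. by rewrite /plt eqxx andbF. Qed.

Lemma plt_le x y : lt x y -> le x y.
Proof. by case/andP. Qed.

(** The largest chain strictly below x; appending x to it shows that ranks stay below the height and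
    increase strictly. *)
Definition rank (x : T) : nat :=
  \max_(C : {set T} | is_chain le C && [forall y in C, lt y x]) #|C|.

Lemma is_chainU1 x (C : {set T}) : is_chain le C -> [forall y in C, lt y x] ->
  is_chain le (x |: C) /\ #|x |: C| = #|C|.+1.
Proof.
move=> /forallP chC /forallP Cx; split; last first.
  rewrite cardsU1; case: (boolP (x \in C)) => // xC.
  by have := Cx x; rewrite xC plt_irr.
apply/forallP => y; apply/implyP; rewrite in_setU1 => /predU1P[->|yC];
  apply/forallP => z; apply/implyP; rewrite in_setU1 => /predU1P[->|zC].
- by rewrite le_refl.
- by have := Cx z; rewrite zC => /plt_le ->; rewrite orbT.
- by have := Cx y; rewrite yC => /plt_le ->.
- by have := chC y; rewrite yC => /forallP/(_ z); rewrite zC.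
Qed.

Lemma rank_attained x : exists2 C : {set T},
  is_chain le C && [forall y in C, lt y x] & rank x = #|C|.
Proof.
pose A := [pred C : {set T} | is_chain le C && [forall y in C, lt y x]].
have A0 : 0 < #|A|.
  apply/card_gt0P; exists set0; rewrite unfold_in /is_chain /=.
  by apply/andP; split; apply/forallP => y; rewrite in_set0.
by have [C CA E] := @eq_bigmax_cond _ A (fun C => #|C|) A0; exists C.
Qed.

Lemma rank_lt_height x : rank x < height le.
Proof.
have [C /andP[chC Cx] ->] := rank_attained x.
have [chx <-] := @is_chainU1 x C chC Cx.
exact: (leq_bigmax_cond (F := fun C : {set T} => #|C|)).
Qed.

Lemma rank_mono x y : lt x y -> rank x < rank y.
Proof.
move=> xy; have [C /andP[chC Cx] ->] := rank_attained x.
have [chx <-] := @is_chainU1 x C chC Cx.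
apply: (leq_bigmax_cond (F := fun C : {set T} => #|C|)); rewrite chx.
apply/forallP => z; apply/implyP; rewrite in_setU1 => /predU1P[->//|zC].
by apply: plt_trans xy; have /forallP/(_ z) := Cx; rewrite zC.
Qed.

(** Induction on the number of elements strictly between x and y, splitting at one of them. *)
Lemma covers_path x y : le x y -> exists2 p, path (covers le) x p & last x p = y.
Proof.
have [m] := ubnP #|[set z | lt x z && lt z y]|; elim: m x y => // m IH x y ltm xy.
case: (eqVneq x y) => [->|nxy]; first by exists [::].
have ltxy : lt x y by rewrite /plt xy.
case: (boolP (covers le x y)) => [cov|]; first by exists [:: y]; rewrite //= cov.
rewrite /covers ltxy negbK => /existsP[z /andP[xz zy]].
have sm (a b : T) : [set t | lt a t && lt t b] \proper [set t | lt x t && lt t y] ->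
    #|[set t | lt a t && lt t b]| < m by move=> /proper_card h; apply: leq_trans h _.
have [|p p1 l1] := IH x z _ (plt_le xz).
  apply: sm; apply/properP; split; last by exists z; rewrite !in_set ?xz ?zy ?plt_irr ?andbF.
  by apply/subsetP => t; rewrite !in_set => /andP[-> /plt_trans]; apply.
have [|q p2 l2] := IH z y _ (plt_le zy).
  apply: sm; apply/properP; split; last by exists z; rewrite !in_set ?xz ?zy ?plt_irr ?andbF.
  by apply/subsetP => t; rewrite !in_set => /andP[zt ->]; rewrite (plt_trans xz zt).
by exists (p ++ q); rewrite ?cat_path ?last_cat l1 ?p1.
Qed.

Lemma path_covers_le x p : path (covers le) x p -> le x (last x p).
Proof.
elim: p x => //= y p IH x /andP[/andP[/plt_le xy _] /IH]; exact: le_trans.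
Qed.

Lemma covers_rpath x y : le x y -> x != y ->
  exists2 p, path [rel a b | covers le b a] y p & last y p = x.
Proof.
move=> /covers_path[[|z p] pp <-]; first by rewrite eqxx.
by move=> _; exists (rev (belast x (z :: p))); rewrite ?rev_path //= rev_cons last_rcons.
Qed.

Lemma path_rcovers_le z p : path [rel a b | covers le b a] z p -> le (last z p) z.
Proof.
elim: p z => //= a p IH z /andP[/andP[/plt_le az _] /IH le1]; exact: le_trans az.
Qed.

Definition hasse_connected (Q : {set T}) := forall x y, x \in Q -> y \in Q ->
  connect [rel a b | [&& a \in Q, b \in Q & adj a b]] x y.

Lemma adjC x y : adj x y = adj y x.
Proof. by rewrite /hasse_adj orbC. Qed.

Lemma hasse_connectedU1 Q v q : hasse_connected Q -> v \in Q -> adj v q -> hasse_connected (q |: Q).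
Proof.
move=> cQ vQ vq; pose e := [rel a b | [&& a \in q |: Q, b \in q |: Q & adj a b]].
have symc : connect_sym e.
  by apply: sym_connect_sym => a b /=; rewrite adjC andbCA.
have toq x : x \in q |: Q -> connect e x q.
  rewrite in_setU1 => /predU1P[->|xQ]; first exact: connect0.
  apply: (@connect_trans _ _ v); last first.
    by apply: connect1; rewrite /= !in_setU1 vQ eqxx orbT.
  apply: connect_sub (cQ x v xQ vQ) => a b /= /and3P[aQ bQ ab].
  by apply: connect1; rewrite /= !in_setU1 aQ bQ ab !orbT.
move=> x y xQ yQ; apply: (@connect_trans _ e q x y (toq x xQ)).
by rewrite symc; exact: toq.
Qed.

Lemma exists_boundary (Q : {set T}) : (forall x y, connect adj x y) ->
  Q != set0 -> Q != setT -> exists v q, [/\ v \in Q, q \notin Q & adj v q].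
Proof.
move=> conn /set0Pn[x xQ]; rewrite -subTset => /subsetPn[y _ yQ].
case: (pickP [pred z : T * T | [&& z.1 \in Q, z.2 \notin Q & adj z.1 z.2]]) => [[v q] /and3P[]|none].
  by exists v, q.
have cl : closed adj (mem Q).
  move=> a b ab; apply/idP/idP => h; apply: contraTT isT => nh.
    by have := none (a, b); rewrite /= h nh ab.
  by have := none (b, a); rewrite /= h nh adjC ab.
by have := closed_connect cl (conn x y); rewrite /= xQ (negbTE yQ).
Qed.

(* Two different attaching points of the outside path would close a cycle through Q. *)
Lemma unique_return Q v q p y : (forall s, ~~ hasse_cycle le s) -> hasse_connected Q ->
  v \in Q -> q \notin Q -> adj v q ->
  path adj q p -> all [predC Q] p -> adj (last q p) y -> y \in Q -> y = v.
Proof.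
move=> acyc cQ vQ qQ vq; case/shortenP => p' pp' up' sub allp lasty yQ.
apply/eqP; apply: contraT => yv.
have /connectP[c0 pc0 lc0] := cQ y v yQ vQ.
move: lc0 yv; case/shortenP: pc0 => c pc uc _ lc yv.
have cin : all (mem Q) c.
  elim: c y {yQ lasty uc lc yv} pc => //= z c IH y /andP[/and3P[_ -> _]] /IH; exact.
have pc' : path adj y c by apply: sub_path pc => a b /and3P[].
(* The cycle runs from y inside Q to v, steps to q, and returns outside Q to y; since y differs from
   v, it has at least three vertices. *)
case/negP: (acyc (y :: c ++ q :: p')); apply/and3P; split.
- by case: c {pc uc cin pc'} lc yv => [->|? ? _ _]; rewrite ?eqxx //= size_cat /= addnS.
- rewrite -cat_cons cat_uniq uc up' andbT andTb; apply/hasPn => z; rewrite inE => zp /=.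
  have zQ : z \notin Q.
    case/predU1P: zp => [->//|zp]; by have := allP allp z (sub z zp).
  rewrite inE negb_or; apply/andP; split; first by apply: contra zQ => /eqP ->.
  by apply: contra zQ => /(allP cin).
- by rewrite /= rcons_cat cat_path pc' /= -lc vq rcons_path pp' lasty.
Qed.

(** Cut the path at its first entry into Q, which must be v. The relation [e] will be covering or
    its converse, so that both pieces are monotone. *)
Lemma first_return Q v q (e : rel T) p : (forall s, ~~ hasse_cycle le s) -> hasse_connected Q ->
  v \in Q -> q \notin Q -> adj v q -> subrel e adj ->
  path e q p -> last q p \in Q ->
  exists p1 p2, [/\ path e q p1, last q p1 = v, path e v p2 & last v p2 = last q p].
Proof.
move=> acyc cQ vQ qQ vq eadj pp lQ.
have hasQ : has (mem Q) p.
  case: p pp lQ => [|z p] _ lQ; first by rewrite lQ in qQ.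
  by apply/hasP; exists (last z p); first exact: mem_last.
case/split_find: hasQ pp lQ => y p1 p2 yQ np1; rewrite cat_path last_cat rcons_path last_rcons.
move=> /andP[/andP[pp1 l1] pp2] lQ.
have yv : y = v.
  apply: (@unique_return Q v q p1) => //; first exact: sub_path pp1.
    by rewrite all_predC.
  exact: eadj.
exists (rcons p1 v), p2; rewrite rcons_path last_rcons pp1 -yv l1; split=> //.
Qed.

Hypothesis htree : is_tree_poset le.

(** A saturated chain between q and a point of Q passes through v. Going up from q it would give q
    <= v, which is absurd; going down to x it gives x <= v. Hence comparabilities with q are decided
    by v alone. *)
Lemma tree_extend_up Q v q x : hasse_connected Q -> v \in Q -> q \notin Q -> covers le v q ->
  x \in Q -> le x q = le x v /\ le q x = false.
Proof.
move=> cQ vQ qQ vq xQ; have [_ _ acyc] := htree.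
have ltvq : lt v q by case/andP: vq.
have vq' : adj v q by rewrite /hasse_adj vq.
split; last first.
  apply/negbTE/negP => /covers_path[p pp lp].
  have [||p1 [p2 [pp1 l1 _ _]]] := @first_return Q v q (covers le) p acyc cQ vQ qQ vq' _ pp.
  - by move=> a b ab; rewrite /hasse_adj ab.
  - by rewrite lp.
  have := path_covers_le pp1; rewrite l1 => qv.
  by move: ltvq => /andP[lvq /negP[]]; apply/eqP/le_anti; rewrite qv lvq.
have xq : x != q by apply: contraNneq qQ => <-.
apply/idP/idP => [/covers_rpath/(_ xq)[p pp lp]|xv]; last exact: le_trans (plt_le ltvq).
have [||p1 [p2 [_ _ pp2 l2]]] := @first_return Q v q _ p acyc cQ vQ qQ vq' _ pp.
- by move=> a b /= ab; rewrite /hasse_adj ab orbT.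
- by rewrite lp.
by have := path_rcovers_le pp2; rewrite l2 lp.
Qed.

Lemma tree_extend_down Q v q x : hasse_connected Q -> v \in Q -> q \notin Q -> covers le q v ->
  x \in Q -> le q x = le v x /\ le x q = false.
Proof.
move=> cQ vQ qQ qv xQ; have [_ _ acyc] := htree.
have ltqv : lt q v by case/andP: qv.
have vq' : adj v q by rewrite /hasse_adj qv orbT.
have xq : x != q by apply: contraNneq qQ => <-.
split; last first.
  apply/negbTE/negP => /covers_rpath/(_ xq)[p pp lp].
  have [||p1 [p2 [pp1 l1 _ _]]] := @first_return Q v q _ p acyc cQ vQ qQ vq' _ pp.
  - by move=> a b /= ab; rewrite /hasse_adj ab orbT.
  - by rewrite lp.
  have := path_rcovers_le pp1; rewrite l1 => vq.
  by move: ltqv => /andP[lqv /negP[]]; apply/eqP/le_anti; rewrite vq lqv.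
apply/idP/idP => [/covers_path[p pp lp]|vx]; last exact: le_trans (plt_le ltqv) vx.
have [||p1 [p2 [_ _ pp2 l2]]] := @first_return Q v q _ p acyc cQ vQ qQ vq' _ pp.
- by move=> a b ab; rewrite /hasse_adj ab.
- by rewrite lp.
by have := path_covers_le pp2; rewrite l2 lp.
Qed.
End TreePosets.

(** * Building the decision tree and counting the induced free families *)

Section Containers.
Local Open Scope nat_scope.
Variables (T : finType) (le : rel T).
Hypotheses (le_refl : reflexive le) (le_anti : antisymmetric le) (le_trans : transitive le).
Hypothesis htree : is_tree_poset le.

Local Notation k := (height le).

Definition level_of (x : T) : 'I_k := Ordinal (rank_lt_height le_refl x).

Lemma height_gt0 : 0 < k.
Proof. by case: htree => /card_gt0P[x _] _ _; apply: leq_trans (rank_lt_height le_refl x). Qed.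

Variables (n R E : nat).
Let D := (k * (k.-1 * E + 1)).+1.
Hypotheses (n_gt0 : 0 < n) (E_gt0 : 0 < E) (R2 : 2 * R <= n) (mDR : 16 * #|T| * D * R <= n).
Let L := ((k.-1 * E + 1) * 'C(n, n./2)) %/ E.
Implicit Types (A F : {set {set 'I_n}}) (Q : {set T}) (f : T -> {set 'I_n}).

Lemma copy_of_embedding F f : (forall x, f x \in F) ->
  (forall x y, (f x \subset f y) = le x y) -> has_induced_copy le F.
Proof.
move=> fF fle; apply/existsP; exists [ffun x => f x]; apply/and3P; split.
- apply/injectiveP => x y; rewrite !ffunE => e; apply: le_anti.
  by rewrite -!fle e subxx.
- by apply/forallP => x; rewrite ffunE.
- apply/forallP => x; apply/forallP => y; rewrite !ffunE properE !fle /plt.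
  case: (eqVneq x y) => [->|xy]; first by rewrite le_refl andbF.
  case: (boolP (le x y)) => //= lxy; apply/eqP/negP => lyx.
  by case/eqP: xy; apply: le_anti; rewrite lxy.
Qed.

Definition embeds_in (V : {set 'I_k * {set 'I_n}}) Q f :=
  (forall x, x \in Q -> (level_of x, f x) \in V) /\
  (forall x y, x \in Q -> y \in Q -> (f x \subset f y) = le x y).

(** Robustness of the image of v supplies candidates on the level of q. Relations between q and Q
    are those dictated by v, so it suffices that u is comparable with f v in the right direction and
    avoids new comparabilities with the other images. *)
Lemma many_extensions A (V : {set 'I_k * {set 'I_n}}) Q f v q :
  (forall u, u \in A -> middle R u) ->
  (forall x, x \in V -> x.2 \in A /\ robust D V x.1 x.2) ->
  hasse_connected le Q -> embeds_in V Q f -> v \in Q -> q \notin Q -> hasse_adj le v q ->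
  exists2 N : {set {set 'I_n}}, n <= 8 * D * #|N| & forall u, u \in N ->
    (level_of q, u) \in V /\
    forall x, x \in Q -> (f x \subset u) = le x q /\ (u \subset f x) = le q x.
Proof.
move=> mA rob cQ [fV fle] vQ qQ vq.
have midV x : x \in V -> middle R x.2 by move=> /rob[/mA].
pose X := [seq f x | x <- enum Q]; pose W := level V (level_of q).
have sX : size X <= #|T| by rewrite size_map -cardE max_card.
have mX : all (middle R) X.
  by apply/allP => _ /mapP[x + ->]; rewrite mem_enum => /fV /midV.
have mW u : u \in W -> middle R u by rewrite inE => /midV.
have memX (P : pred {set 'I_n}) x : x \in Q -> all P X -> P (f x).
  by move=> xQ /allP; apply; rewrite map_f ?mem_enum.
have mfv := midV _ (fV _ vQ).
have [_ /forallP/(_ (level_of q))/andP[/implyP up /implyP down]] := rob _ (fV _ vQ).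
case/orP: vq => [vq|qv].
  have le_vq : level_of v < level_of q by apply: rank_mono => //; case/andP: vq.
  have := @up_many n R #|T| D (f v) X W R2 mDR sX mfv mX mW (up le_vq); set N := [set u in W | _] => cN.
  exists N => // u; rewrite in_set => /and4P[uW fvu a1 a2].
  split=> [|x xQ]; first by rewrite inE in uW.
  have [-> ->] := tree_extend_up le_refl le_anti le_trans htree cQ vQ qQ vq xQ.
  split; last by apply/negbTE; exact: (memX _ x xQ a2).
  rewrite -fle //; apply/idP/idP => [fxu|fxv]; last exact: subset_trans (proper_sub fvu).
  by have := memX _ x xQ a1; rewrite /= fxu orbF.
have le_qv : level_of q < level_of v by apply: rank_mono => //; case/andP: qv.
have := @down_many n R #|T| D (f v) X W R2 mDR sX mfv mX mW (down le_qv); set N := [set u in W | _] => cN.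
exists N => // u; rewrite in_set => /and4P[uW fvu a1 a2].
split=> [|x xQ]; first by rewrite inE in uW.
have [-> ->] := tree_extend_down le_refl le_anti le_trans htree cQ vQ qQ qv xQ.
split; first by apply/negbTE; exact: (memX _ x xQ a2).
rewrite -fle //; apply/idP/idP => [ufx|fvx]; last exact: subset_trans (proper_sub fvu) fvx.
by have := memX _ x xQ a1; rewrite /= ufx orbF.
Qed.

(** Induction on the number of vertices still to be placed. A positive query places one more vertex;
    if all candidates [N] are refused, they leave [A], and the budget 8D|T||N| >= |T|n released pays
    for the |Q| positive answers of the round. *)
Lemma embedding_round A (V : {set 'I_k * {set 'I_n}}) :
  (forall u, u \in A -> middle R u) ->
  (forall x, x \in V -> x.2 \in A /\ robust D V x.1 x.2) ->
  (forall A', A' \proper A -> exists t, forall F, induced_free le F -> F \subset A' ->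
    [/\ #|yes t F| * n <= 8 * D * #|T| * #|A'|, F \subset run t F & #|run t F| <= L]) ->
  forall Q f, Q != set0 -> hasse_connected le Q -> embeds_in V Q f ->
  exists t, forall F, [/\ induced_free le F, F \subset A & forall x, x \in Q -> f x \in F] ->
    [/\ (#|yes t F| + #|Q|) * n <= 8 * D * #|T| * #|A|, F \subset run t F & #|run t F| <= L].
Proof.
move=> mA rob IHA Q; have [d] := ubnP #|~: Q|; elim: d Q => // d IH Q ltd f Q0 cQ fQ.
case: (eqVneq Q setT) => [QT|QT].
  (* A completed embedding contradicts freeness, so the content of this leaf is arbitrary. *)
  exists (Leaf set0) => F [freeF _ fF]; case/negP: freeF; apply: (copy_of_embedding (f := f)) => x.
    by apply: fF; rewrite QT.
  by move=> y; apply: fQ.2; rewrite QT.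
have [_ conn _] := htree.
have [v [q [vQ qQ vq]]] := exists_boundary conn Q0 QT.
have [N cN HN] := many_extensions mA rob cQ fQ vQ qQ vq.
have NA : N \subset A by apply/subsetP => u /HN[/rob[]].
apply: (@query_seq _ n L _ #|Q| (enum N)) => [u|].
  rewrite mem_enum => /HN[uV Hu]; pose f' x := if x == q then u else f x.
  have f'Q x : x \in Q -> f' x = f x.
    by move=> xQ; rewrite /f'; case: eqP => // xq; rewrite -xq xQ in qQ.
  have f'q : f' q = u by rewrite /f' eqxx.
  have [||||t Ht] := IH (q |: Q) _ f'.
  - rewrite -ltnS; apply: leq_trans ltd; rewrite ltnS; apply: proper_card; rewrite properC.
    by apply/properP; split; [exact: subsetUr | exists q; rewrite ?setU11].
  - by apply/set0Pn; exists q; rewrite setU11.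
  - exact: hasse_connectedU1 vQ vq.
  - split=> [x|x y]; rewrite !in_setU1.
      by move=> /predU1P[->|xQ]; rewrite ?f'q ?f'Q //; exact: fQ.1.
    move=> /predU1P[->|xQ] /predU1P[->|yQ]; rewrite ?f'q ?f'Q ?subxx ?le_refl //.
    + by have [] := Hu y yQ.
    + by have [] := Hu x xQ.
    + exact: fQ.2.
  exists t => F [freeF FA fF] uF; rewrite -[#|Q|.+1]add1n.
  have <- : #|q |: Q| = 1 + #|Q| by rewrite cardsU1 qQ.
  apply: Ht; split=> // x; rewrite in_setU1 => /predU1P[->|xQ]; first by rewrite f'q.
  by rewrite f'Q // fF.
have N0 : 0 < #|N| by move: cN n_gt0; case: #|N| => //; rewrite muln0; lia.
have cAN : #|A :\: N| + #|N| = #|A| by rewrite cardsDS // subnK // subset_leq_card.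
have [|t Ht] := IHA (A :\: N).
  by rewrite properEcard subsetDl /= -cAN -[ltnLHS]addn0 ltn_add2l.
exists t => F [freeF FA _] FN.
have [|h1 h2 h3] := Ht F freeF.
  rewrite subsetD FA disjoint_sym; apply/pred0P => u /=.
  by apply/negbTE/negP => /andP[uN uF]; have := FN u; rewrite mem_enum uF => /(_ uN).
split=> //; rewrite mulnDl -cAN mulnDr leq_add //.
apply: (@leq_trans (#|T| * (8 * D * #|N|))); first exact: leq_mul (max_card _) cN.
by rewrite leq_eqVlt; apply/orP; left; apply/eqP; ring.
Qed.

(** Induction on |A|. Below the threshold, A itself is the container; above it, a robust system
    starts a round by placing an arbitrary root p. *)
Lemma container_tree A : (forall u, u \in A -> middle R u) ->
  exists t, forall F, induced_free le F -> F \subset A ->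
    [/\ #|yes t F| * n <= 8 * D * #|T| * #|A|, F \subset run t F & #|run t F| <= L].
Proof.
have [d] := ubnP #|A|; elim: d A => // d IH A ltd mA.
case: (leqP ((k.-1 * E + 1) * 'C(n, n./2)) (#|A| * E)) => [big|small]; last first.
  exists (Leaf A) => F _ FA; rewrite /= cards0; split=> //.
  by rewrite /L leq_divRL // ltnW.
have [V V0 rob] := @robust_exists n k E A height_gt0 big.
have IHA A' : A' \proper A -> exists t, forall F, induced_free le F -> F \subset A' ->
    [/\ #|yes t F| * n <= 8 * D * #|T| * #|A'|, F \subset run t F & #|run t F| <= L].
  move=> A'A; apply: IH => [|u uA']; first exact: leq_trans (proper_card A'A) ltd.
  by apply: mA; apply: (subsetP (proper_sub A'A)).
have [/card_gt0P[p _] _ _] := htree.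
pose W := level V (level_of p).
(* Any surviving (i, F) has chains hitting every other level, so no level is empty. *)
have W0 : W != set0.
  have /set0Pn[[i F] iF] := V0; have [_ /forallP/(_ (level_of p))/andP[]] := rob _ iF.
  have thF := through_gt0 F.
  case: (ltngtP i (level_of p)) => /= [_ h _|_ _ h|ei _ _].
  - have : 0 < #|up_hits F (level V (level_of p))|.
      by move: (leq_trans thF h); rewrite muln_gt0 => /andP[].
    case/card_gt0P=> s; rewrite in_set => /andP[_ /existsP[u /and3P[uW _ _]]].
    by apply/set0Pn; exists u.
  - have : 0 < #|down_hits F (level V (level_of p))|.
      by move: (leq_trans thF h); rewrite muln_gt0 => /andP[].
    case/card_gt0P=> s; rewrite in_set => /andP[_ /existsP[u /and3P[uW _ _]]].
    by apply/set0Pn; exists u.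
  - by apply/set0Pn; exists F; rewrite in_set (_ : level_of p = i) //; apply: val_inj.
have WA : W \subset A by apply/subsetP => u; rewrite in_set => /rob[].
have [||t Ht] := @query_seq _ n L (8 * D * #|T| * #|A|) 0 (enum W)
    (fun F => induced_free le F /\ F \subset A).
- move=> u; rewrite mem_enum in_set => uV.
  have [|x y||t Ht] := embedding_round mA rob IHA (Q := [set p]) (f := fun=> u).
  + by apply/set0Pn; exists p; rewrite set11.
  + by rewrite !in_set1 => /eqP -> /eqP ->; exact: connect0.
  + split=> [x|x y]; rewrite !in_set1; first by move/eqP->.
    by move=> /eqP-> /eqP->; rewrite subxx le_refl.
  exists t => F [freeF FA] uF; have := Ht F; rewrite cards1; apply; split=> // x _.
- have [|t Ht] := IHA (A :\: W).
    rewrite properEcard subsetDl /= cardsDS //.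
    have := subset_leq_card WA; have : 0 < #|W| by rewrite card_gt0.
    move: #|W| #|A| => a b; lia.
  exists t => F [freeF FA] FW; have [|h1 h2 h3] := Ht F freeF.
    rewrite subsetD FA disjoint_sym; apply/pred0P => u /=.
    by apply/negbTE/negP => /andP[uN uF]; have := FW u; rewrite mem_enum uF => /(_ uN).
  by split=> //; rewrite addn0 (leq_trans h1) // leq_mul2l subset_leq_card ?orbT ?subsetDl.
exists t => F freeF FA; have := Ht F (conj freeF FA); by rewrite addn0.
Qed.

Lemma induced_freeS F F' : F' \subset F -> induced_free le F -> induced_free le F'.
Proof.
move=> F'F; apply: contra => /existsP[f /and3P[inj /forallP fF' ord]].
apply/existsP; exists f; rewrite inj ord /= andbT; apply/forallP => x.
exact: (subsetP F'F).
Qed.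

(** The trace of F on the middle layers is again induced free and is counted by fingerprint and
    container; the trace on the remaining sets is arbitrary. *)
Lemma count_induced_free (l : nat) : l < n ->
  #|[set F : {set {set 'I_n}} | induced_free le F]| <=
    2 ^ (l.+1 * ((8 * D * #|T| * 2 ^ n) %/ n) + 2 ^ (n - l) + L
         + #|[set u : {set 'I_n} | ~~ middle R u]|).
Proof.
move=> ln; set s := _ %/ n; pose M := [set u : {set 'I_n} | middle R u].
have c2n : #|{set 'I_n}| = 2 ^ n by rewrite -cardsT -powersetT card_powerset cardsT card_ord.
have [|t Ht] := @container_tree M; first by move=> u; rewrite inE.
pose P := [pred F : {set {set 'I_n}} | induced_free le F && (F \subset M)].
have cP : #|[set F | P F]| <= 2 ^ (l.+1 * s + 2 ^ (n - l)) * 2 ^ L.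
  have cnt : #|[set F | P F]| <= #|[set S : {set {set 'I_n}} | #|S| <= s]| * 2 ^ L.
    apply: (@dtree_count _ P t s L) => F /andP[freeF FM].
    have [h1 -> ->] := Ht F freeF FM; rewrite !andbT.
    by rewrite /s leq_divRL // (leq_trans h1) // leq_mul2l -c2n max_card orbT.
  by apply: (leq_trans cnt); rewrite leq_mul2r small_sets_pow2 ?orbT.
set Mc := [set u | ~~ middle R u].
have eMc : Mc = ~: M by apply/setP => u; rewrite !in_set.
rewrite expnD [X in X * _]expnD -(card_powerset Mc); apply: leq_trans (leq_mul cP (leqnn _)).
rewrite -cardsX.
have inj : injective (fun F : {set {set 'I_n}} => (F :&: M, F :&: Mc)).
  by move=> F G [e1 e2]; rewrite -(setID F M) -(setID G M) !setDE -eMc e1 e2.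
rewrite -(card_imset _ inj); apply: subset_leq_card; apply/subsetP => _ /imsetP[F + ->].
rewrite in_set => freeF; rewrite in_setX in_set powersetE subsetIr andbT /= subsetIr andbT.
by apply: induced_freeS freeF; exact: subsetIl.
Qed.

End Containers.

(** * Choice of parameters and estimates of the error terms *)

Section Asymptotics.
Local Open Scope nat_scope.

Lemma square_le_pow2 (c l : nat) : 8 * c <= l -> c * l.+1 ^ 2 <= 2 ^ l.
Proof.
have cube m : m.+1 ^ 3 <= 8 * 2 ^ m.
  elim: m => // m IH; case: (ltnP m 3) => [|m3]; first by case: m IH => [|[|[|]]].
  by rewrite (expnS 2); move: IH; rewrite !expnS !expn0 !muln1; nia.
move=> cl; rewrite -(leq_pmul2l (m := 8)) //; apply: leq_trans (cube l).
by rewrite mulnA (expnS _ 2) leq_mul2r (leq_trans cl) ?orbT.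
Qed.

(** After squaring, [central_bound] reduces this to 4 c^2 (l+1)^2 <= n, which holds because n is
    exponential in l. *)
Lemma log_mul_pow2_le (c n l : nat) : 2 ^ l <= n -> 32 * c ^ 2 <= l ->
  c * l.+1 * 2 ^ n <= n * 'C(n, n./2).
Proof.
move=> ln cl; have n0 : 0 < n by apply: leq_trans ln; rewrite expn_gt0.
rewrite -(@leq_exp2r _ _ 2) // !expnMn.
apply: (@leq_trans (c ^ 2 * l.+1 ^ 2 * (4 * n * 'C(n, n./2) ^ 2))).
  by rewrite leq_mul2l central_bound // orbT.
have small : 4 * c ^ 2 * l.+1 ^ 2 <= n.
  by apply: leq_trans ln; apply: square_le_pow2; rewrite mulnA.
move: ('C(n, n./2) ^ 2) => N; apply: (@leq_trans (4 * c ^ 2 * l.+1 ^ 2 * (n * N))).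
  by rewrite leq_eqVlt; apply/orP; left; apply/eqP; ring.
by rewrite (expnS n 1) expn1 -[leqRHS]mulnA leq_mul2r small orbT.
Qed.

Lemma induced_free_bound (T : finType) (le : rel T) :
  reflexive le -> antisymmetric le -> transitive le -> is_tree_poset le ->
  forall E : nat, 0 < E -> exists n0, forall n, n0 <= n -> exists2 X,
    #|[set F : {set {set 'I_n}} | induced_free le F]| <= 2 ^ X &
    X * E <= ((height le).-1 * E + 2) * 'C(n, n./2).
Proof.
move=> refl anti trans tree E E0.
set k1 := (height le).-1; pose D := (height le * (k1 * E + 1)).+1.
(* With R about n/K the spoilt chains stay rare. The summands of [c] bound the fingerprint size, the
   term 2^(n-l) and the sets outside the middle, each in units of 2^n / n. *)
pose K := 16 * #|T| * D; pose c := E * (8 * D * #|T| + 2 + 4 * K ^ 2).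
have T0 : 0 < #|T| by case: tree.
have K2 : 2 <= K by rewrite /K -!mulnA -[2]/(2 * 1) leq_mul // !muln_gt0 T0.
exists (2 ^ (32 * c ^ 2 + K)) => n nbig.
have n0 : 0 < n by apply: leq_trans nbig; rewrite expn_gt0.
pose l := trunc_log 2 n; pose R := n %/ K.
have l1 : 2 ^ l <= n by exact: trunc_logP.
have l2 : n < 2 ^ l.+1 by exact: trunc_log_ltn.
have ln : l < n by apply: leq_trans l1; exact: ltn_expl.
have cl : 32 * c ^ 2 + K <= l by apply: trunc_log_max.
have Kn : K <= n.
  by rewrite (leq_trans _ nbig) // (leq_trans (ltnW (ltn_expl K (ltnSn 1)))) // leq_exp2l // leq_addl.
have RK : K * R <= n by rewrite mulnC leq_trunc_div.
have R1 : 0 < R by rewrite /R divn_gt0 // ltnW.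
have nR : n <= 2 * K * R.
  apply: leq_trans (ltnW (ltn_ceil n (ltnW K2))) _.
  by rewrite -/R [leqRHS]mulnAC leq_mul2r; apply/orP; right; clear -R1; lia.
have R2 : 2 * R <= n by apply: leq_trans RK; rewrite leq_mul2r K2 orbT.
have := @count_induced_free T le refl anti trans tree n R E n0 E0 R2 RK l ln.
rewrite -/k1 -/D; set s := _ %/ n; set L := _ %/ E; set O := #|[set u | ~~ middle R u]|.
move=> count; exists (l.+1 * s + 2 ^ (n - l) + L + O) => //.
have hs : s * n <= 8 * D * #|T| * 2 ^ n by exact: leq_trunc_div.
have hl : 2 ^ (n - l) * n <= 2 * 2 ^ n.
  apply: (@leq_trans (2 ^ (n - l) * 2 ^ l.+1)); first by rewrite leq_mul2l ltnW ?orbT.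
  by rewrite -expnD -expnS addnS subnK // ltnW.
have hO : O * n <= 4 * K ^ 2 * 2 ^ n.
  have h : O * R ^ 2 <= n * 2 ^ n := card_outside n R; rewrite -(leq_pmul2r n0).
  apply: (@leq_trans (4 * K ^ 2 * (O * R ^ 2))).
    apply: (@leq_trans (O * (2 * K * R * (2 * K * R)))).
      by rewrite -mulnA leq_mul2l leq_mul ?orbT.
    by rewrite leq_eqVlt; apply/orP; left; apply/eqP; ring.
  by rewrite -[leqRHS]mulnA leq_mul2l (mulnC (2 ^ n)) h orbT.
have hL : L * E <= (k1 * E + 1) * 'C(n, n./2) by exact: leq_trunc_div.
have hN := @log_mul_pow2_le c n l l1 (leq_trans (leq_addr _ _) cl).
have small : (l.+1 * s + 2 ^ (n - l) + O) * E <= 'C(n, n./2).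
  rewrite -(leq_pmul2l n0); apply: leq_trans hN.
  move: hs hl hO; rewrite /c.
  move: (2 ^ (n - l)) (2 ^ n) (8 * D * #|T|) (4 * K ^ 2) => y P a b hs hl hO.
  apply: (@leq_trans (E * (l.+1 * (s * n) + y * n + O * n))).
    by rewrite leq_eqVlt; apply/orP; left; apply/eqP; ring.
  rewrite -!mulnA leq_mul2l; apply/orP; right.
  apply: (@leq_trans (l.+1 * (a * P) + l.+1 * (2 * P) + l.+1 * (b * P))).
    by rewrite !leq_add ?leq_mul2l ?hs ?orbT // (leq_trans _ (leq_pmull _ _)).
  by rewrite leq_eqVlt; apply/orP; left; apply/eqP; ring.
(* One unit of surplus is spent on the container size, the other on all error terms together. *)
have -> : (k1 * E + 2) * 'C(n, n./2) = (k1 * E + 1) * 'C(n, n./2) + 'C(n, n./2) by ring.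
apply: leq_trans (leq_add hL small); rewrite -mulnDl leq_mul2r; apply/orP; right.
by rewrite leq_eqVlt; apply/orP; left; apply/eqP; ring.
Qed.
End Asymptotics.

(** * From the integer estimate to the bound with a real exponent *)

Unset Implicit Arguments. Set Strict Implicit.

Theorem theorem1p5 (R : realType) (T : finType) (le : rel T)
  (le_refl : reflexive le) (le_anti : antisymmetric le)
  (le_trans : transitive le)
  (htree : is_tree_poset le) (k : nat) (hk : height le = k)
  (eps : R) (heps : 0 < eps) :
  exists n0 : nat, forall n : nat, (n0 <= n)%N ->
    (#|[set F : {set {set 'I_n}} | induced_free le F]|%:R : R)
      <= 2 `^ ((k%:R - 1 + eps) * ('C(n, n./2))%:R).
Proof.
(* The integer bound has exponent (k - 1 + 2/E) times the central coefficient, hence the requirement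
   2/E <= eps. *)
have [E E0 hE] : exists2 E : nat, (0 < E)%N & 2 <= eps * E%:R.
  exists (Num.bound (2 / eps)).+1 => //.
  rewrite mulrC -ler_pdivrMr // ltW // (lt_le_trans (archi_boundP _)) ?ler_nat //.
  by rewrite divr_ge0 // ltW.
have [n0 Hn0] := @induced_free_bound T le le_refl le_anti le_trans htree E E0.
exists n0 => n /Hn0[X cX hX].
(* Positivity makes the truncated predecessor of k agree with the real number k - 1. *)
have k0 : (0 < k)%N by rewrite -hk; exact: height_gt0.
apply: (@Order.POrderTheory.le_trans _ _ ((2 ^ X)%N%:R)); first by rewrite ler_nat.
rewrite natrX -powR_mulrn ?ler0n // ler_powR ?ler1n //.
have ER : 0 < E%:R :> R by rewrite ltr0n.
rewrite -(ler_pM2r ER) -natrM.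
apply: (@Order.POrderTheory.le_trans _ _ ((((height le).-1 * E + 2) * 'C(n, n./2))%N%:R)); first by rewrite ler_nat.
rewrite natrM mulrAC ler_wpM2r ?ler0n // natrD natrM hk mulrDl lerD //.
by rewrite -subn1 natrB.
Qed.
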